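(* Let $X$ be a weighted graph as in the context and $M\in\{A,L\}$. If pretty good state transfer or proper fractional revival occurs between two twin vertices $u$ and $v$ of $X$, then $u$ and $v$ are strongly cospectral.
   Context: $X$ is a connected weighted undirected graph (finite vertex set, no multiple edges, loops allowed, all edge/loop weights nonzero reals); $A$ is the weighted adjacency matrix, $D$ the diagonal degree matrix with $\deg(u)=2\omega_{u,u}+\sum_j\omega_{u,j}$, $L=D-A$; $U(t)=e^{itM}$. Two distinct vertices $u,v$ are twins if they have the same neighbours outside $\{u,v\}$, the edges from $u$ and $v$ to each common neighbour have equal weights, and their loops have equal weight (zero if absent). With spectral decomposition $M=\sum_j\lambda_jE_j$ (distinct eigenvalues, orthogonal projections), $u,v$ are strongly cospectral if $E_j\mathbf e_u=\pm E_j\mathbf e_v$ for each $j$. Pretty good state transfer between $u,v$: for every $\epsilon>0$ there is $\tau$ with $|U(\tau)_{u,v}|^2>1-\epsilon$. Fractional revival from $u$ to $v$ at time $\tau$: $|U(\tau)_{u,u}|^2+|U(\tau)_{u,v}|^2=1$; it is proper if $U(\tau)_{u,v}\neq0$. *)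

(* Defs.v *)
From HB Require Import structures.
From mathcomp Require Import all_boot all_order all_algebra.
From mathcomp Require Import all_classical all_reals all_analysis.
From mathcomp Require Import complex.

Set Implicit Arguments.
Unset Strict Implicit.
Unset Printing Implicit Defensive.

Import Order.TTheory GRing.Theory Num.Theory.
Import numFieldNormedType.Exports.

Local Open Scope ring_scope.
Local Open Scope complex_scope.

(* Every edge or loop of the graph has nonzero weight, so the symmetric weight
   matrix determines the graph: i and j are adjacent (for i = j: there is a
   loop at i) iff the (i, j) weight is nonzero. *)
Record wgraph (R : realType) (n : nat) := WGraph {
  adjmx : 'M[R]_n;
  adjmx_sym : forall i j : 'I_n, adjmx i j = adjmx j i
}.

Section WeightedGraph.
Variables (R : realType) (n : nat).
Implicit Types (X : wgraph R n) (M : 'M[R]_n) (i j u v : 'I_n).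

Definition adjacent X : rel 'I_n := fun i j => adjmx X i j != 0.

Definition connected_graph X : Prop := forall i j, connect (adjacent X) i j.

Definition neighbours X u : {set 'I_n} := [set j | adjacent X u j].

(* The sum ranges over all vertices, u included. *)
Definition degree X u : R := 2 * adjmx X u u + \sum_j adjmx X u j.

Definition degmx X : 'M[R]_n := diag_mx (\row_u degree X u).

Definition lapmx X : 'M[R]_n := degmx X - adjmx X.

(* Absent loops have weight 0, so the last clause covers loopless vertices. *)
Definition twins X u v : Prop :=
  [/\ u != v,
      neighbours X u :\: [set u; v] = neighbours X v :\: [set u; v],
      forall w, w \in neighbours X u :\: [set u; v] ->
        adjmx X u w = adjmx X v w
    & adjmx X u u = adjmx X v v].

(* The orthogonal projection onto the eigenspace {x | x M = l x} of l: the
   projection along its orthogonal complement, which is the row space of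
   kermx S^T. *)
Definition eigenproj M (l : R) : 'M[R]_n :=
  let S := eigenspace M l in proj_mx S (kermx S^T).

(* The idempotents E_j of the spectral decomposition M = \sum_j l_j E_j are
   the eigenproj M l for l an eigenvalue of M: see spectral_eigenproj. *)
Definition strongly_cospectral M u v : Prop :=
  forall l : R, eigenvalue M l ->
    eigenproj M l *m delta_mx u 0 = eigenproj M l *m delta_mx v 0 :> 'cV[R]_n
    \/
    eigenproj M l *m delta_mx u 0 = - (eigenproj M l *m delta_mx v 0)
      :> 'cV[R]_n.

Lemma spectral_eigenproj M (m : nat) (l : 'I_m -> R) (E : 'I_m -> 'M[R]_n) :
    injective l ->
    (forall j : 'I_m, (E j)^T = E j) ->
    (forall i j : 'I_m, E i *m E j = if i == j then E i else 0) ->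
    \sum_j E j = 1%:M ->
    M = \sum_j l j *: E j ->
  forall j : 'I_m, eigenproj M (l j) = E j.
Proof.
move=> l_inj Esym Emul Esum ME j.
have EM (i : 'I_m) : E i *m M = l i *: E i.
  rewrite ME mulmx_sumr (bigD1 i) //= -scalemxAr Emul eqxx big1 ?addr0 //.
  by move=> k ki; rewrite -scalemxAr Emul eq_sym (negbTE ki) scaler0.
have ME' (i : 'I_m) : M *m E i = l i *: E i.
  rewrite ME mulmx_suml (bigD1 i) //= -scalemxAl Emul eqxx big1 ?addr0 //.
  by move=> k ki; rewrite -scalemxAl Emul (negbTE ki) scaler0.
rewrite /eigenproj; set S := eigenspace M (l j).
have ES : (E j <= S)%MS by apply/eigenspaceP; exact: EM.
have SM : S *m M = l j *: S by apply/eigenspaceP.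
have SE : S = S *m E j.
  rewrite -[LHS]mulmx1 -Esum mulmx_sumr (bigD1 j) //= big1 ?addr0 // => i ij.
  have : l j *: (S *m E i) = l i *: (S *m E i).
    by rewrite scalemxAl -SM -mulmxA ME' scalemxAr.
  move/eqP; rewrite -subr_eq0 -scalerBl scaler_eq0 subr_eq0 => /orP[|/eqP //].
  by move=> /eqP/l_inj ji; rewrite ji eqxx in ij.
have cap0 : (S :&: kermx S^T)%MS = 0.
  apply/eqP/rowV0P => x; rewrite sub_capmx => /andP[/submxP[y xy] /sub_kermxP].
  rewrite xy => /(congr1 (mulmxr y^T)) /=; rewrite mul0mx -mulmxA -trmx_mul.
  move=> /matrixP/(_ 0 0); rewrite -xy !mxE => /eqP.
  rewrite psumr_eq0 => [/allP x0|k _]; last by rewrite mxE sqr_ge0.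
  apply/rowP => k; have := x0 k (mem_index_enum k).
  by rewrite !mxE mulf_eq0 orbb => /eqP.
have EK : (1%:M - E j <= kermx S^T)%MS.
  have SE' : E j *m S^T = S^T by rewrite -[in LHS](Esym j) -trmx_mul -SE.
  by apply/sub_kermxP; rewrite mulmxBl mul1mx SE' subrr.
have -> : proj_mx S (kermx S^T) =
    E j *m proj_mx S (kermx S^T) + (1%:M - E j) *m proj_mx S (kermx S^T).
  by rewrite -mulmxDl addrC subrK mul1mx.
by rewrite (proj_mx_id cap0 ES) (proj_mx_0 cap0 EK) addr0.
Qed.

End WeightedGraph.

(* Matrices carry the sup norm of their entries, so this is the entrywise sum
   of the exponential series. *)
Definition expmx (K : numFieldType) (n : nat) (A : 'M[K^o]_n) : 'M[K^o]_n :=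
  limn (series (fun k : nat => (k`!%:R : K)^-1 *: (A ^+ k))).

Section StateTransfer.
Variables (R : realType) (n : nat).
Implicit Types (M : 'M[R]_n) (t : R) (u v : 'I_n).

Definition transmx M t : 'M[R[i]]_n :=
  expmx ('i * t%:C *: map_mx (real_complex R) M).

(* The norm of a complex number is an element of R[i] with null imaginary
   part; reals are ordered inside R[i]. *)
Definition pretty_good_state_transfer M u v : Prop :=
  forall e : R, 0 < e ->
    exists t : R, (1 - e)%:C < `|transmx M t u v| ^+ 2.

Definition fractional_revival M u v t : Prop :=
  `|transmx M t u u| ^+ 2 + `|transmx M t u v| ^+ 2 = 1.

Definition proper_fractional_revival M u v : Prop :=
  exists t : R, fractional_revival M u v t /\ transmx M t u v != 0.

End StateTransfer.

(* Main.v *)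
Require Import Defs.
From mathcomp Require Import all_boot all_order all_algebra.
From mathcomp Require Import all_classical all_reals all_analysis.
From mathcomp Require Import complex perm ring lra.

(* For twins u and v the vector e_u - e_v is an eigenvector of M, for some
   eigenvalue theta, so E_l e_u = E_l e_v for every other eigenvalue l, and
   strong cospectrality says that E_theta (e_u + e_v) = 0.  Let s be the
   squared norm of e_u - E_theta e_u = e_v - E_theta e_v.  The squared norm of
   E_theta (e_u + e_v) is 2 - 4 s, hence s <= 1/2, and s = 1/2 is what has to
   be shown.  With z = exp(i t theta) the spectral decomposition gives
     U(t)_(u,v) = Q - s z  and  U(t)_(u,u) = Q + (1 - s) z  with |Q| <= s.
   Thus |U(t)_(u,v)| <= 2 s, which excludes pretty good state transfer when
   s < 1/2; and when s < 1/2, |U(t)_(u,u)|^2 + |U(t)_(u,v)|^2 = 1 forces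
   Q = s z, so that U(t)_(u,v) = 0. *)

Set Implicit Arguments.
Unset Strict Implicit.
Unset Printing Implicit Defensive.

Import Order.TTheory GRing.Theory Num.Theory numFieldNormedType.Exports.

Local Open Scope classical_set_scope.
Local Open Scope ring_scope.
Local Open Scope complex_scope.

(** * The exponential series on the imaginary axis *)

Definition cis (R : realType) (s : R) : R[i] := cos s +i* sin s.

Lemma normr_cis (R : realType) (s : R) : `|cis s| = 1.
Proof. by rewrite normc_def /= cos2Dsin2 sqrtr1. Qed.

Lemma cvg_complex (R : realType) (a b : R^nat) (x y : R) :
  a @ \oo --> x -> b @ \oo --> y ->
  (fun k => a k +i* b k : R[i]^o) @ \oo --> (x +i* y : R[i]^o).
Proof.
move=> ax b_y; apply/cvgrPdist_lt => e e0.
have [r eE] : exists r, e = r%:C by apply/complex_realP; exact: gtr0_real.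
have r0 : 0 < r / 2 by rewrite divr_gt0// -ltcR -eE.
move/cvgrPdist_lt: ax => /(_ _ r0) ax.
move/cvgrPdist_lt: b_y => /(_ _ r0) b_y.
near=> k.
have -> : (x +i* y - (a k +i* b k) : R[i]) = (x - a k)%:C + 'i * (y - b k)%:C.
  by simpc.
rewrite (le_lt_trans (ler_normD _ _))// normrM.
have -> : `|'i : R[i]| = 1 by rewrite normc_def /= expr0n expr1n add0r sqrtr1.
rewrite mul1r !normc_def /= !expr0n !addr0 !sqrtr_sqr -rmorphD/= eE ltcR.
rewrite [r]splitr ltrD//; near: k.
Unshelve. all: by end_near. Qed.

Lemma expi_coeffE (R : realType) (s : R) k :
  (k`!%:R : R[i])^-1 * ('i * s%:C) ^+ k = cos_coeff s k +i* sin_coeff s k.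
Proof.
(* This is the parity form of the cosine and sine coefficients. At [k = 0] the truncated [k.-1] is
   harmless, since its term carries the factor [odd k]. *)
have iE : ('i : R[i]) ^+ k =
    ((~~ odd k)%:R * (-1) ^+ k./2) +i* ((odd k)%:R * (-1) ^+ k.-1./2).
  have N1E j : (-1 : R[i]) ^+ j = ((-1) ^+ j)%:C by rewrite rmorphXn/= rmorphN1.
  rewrite -{1}(odd_double_half k) exprD -mul2n exprM sqr_i N1E.
  case: (boolP (odd k)) => ok; last by rewrite expr0 /=; simpc.
  rewrite -{3}(odd_double_half k) ok add1n /= doubleK expr1; by simpc.
rewrite exprMn iE -rmorphXn/= -(rmorph_nat (real_complex R)) -fmorphV.
rewrite /cos_coeff /sin_coeff /=; simpc.
by congr (_ +i* _); rewrite mulrC.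
Qed.

Lemma cvg_series_cis (R : realType) (s : R) :
  series (fun k => (k`!%:R : R[i])^-1 * ('i * s%:C) ^+ k : R[i]^o) @ \oo -->
    (cis s : R[i]^o).
Proof.
have -> : series (fun k => (k`!%:R : R[i])^-1 * ('i * s%:C) ^+ k : R[i]^o) =
  (fun k => series (cos_coeff s) k +i* series (sin_coeff s) k).
  apply/funext => N; rewrite /series /=.
  elim: N => [|N IH]; first by rewrite !big_nil.
  by rewrite !big_nat_recr//= IH expi_coeffE.
(* Unlocked, [cos] and [sin] are the limits of these very series, so only convergence remains. *)
apply: cvg_complex; [rewrite cos.unlock | rewrite sin.unlock].
  exact: is_cvg_series_cos_coeff.
exact: is_cvg_series_sin_coeff.
Qed.

(** Let [x] be the real part of [Q * z^*]. Expanding the equation with [|z| = 1] gives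
    [(1 - 2 r) (r - x) = |Q|^2 - r^2]. The left side is nonnegative and the right side nonpositive,
    so [x = r = |Q|], which forces [Q = r z]. *)
Lemma sum_sqr_norms_eq1 (R : rcfType) (Q z : R[i]) (r : R) :
  0 <= r -> r < 1 / 2 -> `|z| = 1 -> `|Q| <= r%:C ->
  `|Q + (1 - r)%:C * z| ^+ 2 + `|Q - r%:C * z| ^+ 2 = 1 -> Q - r%:C * z = 0.
Proof.
case: Q z => [q1 q2] [z1 z2] r0 r2.
move=> /(congr1 (fun x => x ^+ 2)) /=; rewrite expr1n -add_Re2_Im2 => -[/= z1E].
move=> Qr; have : `|q1 +i* q2| ^+ 2 <= r%:C ^+ 2.
  by apply: lerXn2r; rewrite ?nnegrE ?normr_ge0 ?ler0c.
rewrite -add_Re2_Im2 -rmorphXn lecR /= => Qle.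
rewrite -!add_Re2_Im2 -rmorphD; simpc => -[/= E].
(* [x] and [- y] are the real and imaginary parts of [Q * z^*]. *)
pose x := q1 * z1 + q2 * z2; pose y := q1 * z2 - q2 * z1.
have xyE : q1 ^+ 2 + q2 ^+ 2 = x ^+ 2 + y ^+ 2.
  by rewrite -[LHS]mulr1 -z1E /x /y; ring.
have xr : x <= r.
  rewrite leNgt; apply/negP => rx; have := sqr_ge0 y; nra.
have Exr : (1 - 2 * r) * (r - x) = - (r ^+ 2 - (q1 ^+ 2 + q2 ^+ 2)).
  have : 2 * (q1 ^+ 2 + q2 ^+ 2) + 2 * (1 - 2 * r) * x +
      ((1 - r) ^+ 2 + r ^+ 2) * (z1 ^+ 2 + z2 ^+ 2) = 1.
    by rewrite -[RHS]E /x; ring.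
  rewrite z1E; lra.
have xrE : x = r.
  by apply/eqP; rewrite eq_le xr/= leNgt; apply/negP => xr'; nra.
have y0 : y = 0.
  apply/eqP; rewrite -sqrf_eq0; apply/eqP.
  have := sqr_ge0 y; move: Exr; rewrite xyE xrE; lra.
have q1E : q1 = z1 * x + z2 * y by rewrite -[LHS]mulr1 -z1E /x /y; ring.
have q2E : q2 = z2 * x - z1 * y by rewrite -[LHS]mulr1 -z1E /x /y; ring.
rewrite q1E q2E y0 xrE !mulr0 subr0 addr0; apply/eqP.
by rewrite eq_complex /= mulrC subrr mulrC subrr eqxx.
Qed.

(** * Spectral decomposition of the transition matrix *)

Lemma spectral_real_sym (R : realType) n (M : 'M[R]_n) : M^T = M ->
  exists (P : 'M[R[i]]_n) (d : 'I_n -> R),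
    P \is unitarymx /\
    map_mx (real_complex R) M =
      (P ^t*)%sesqui *m diag_mx (\row_k (d k)%:C) *m P.
Proof.
move=> Msym; set MC := map_mx _ M.
have Mherm : MC \is hermsymmx.
  apply: realsym_hermsym.
    apply/is_hermitianmxP; rewrite expr0 scale1r map_mx_id//.
    by apply/matrixP => i j; rewrite !mxE -[in LHS]Msym mxE.
  by apply/mxOverP => i j; rewrite mxE complex_real.
have /orthomx_spectralP ME := hermitian_normalmx Mherm.
have /mxOverP dreal := hermitian_spectral_diag_real Mherm.
exists (spectralmx MC), (fun k => complex.Re (spectral_diag MC 0 k)).
split; first exact: spectral_unitarymx.
rewrite {1}ME invmx_unitary ?spectral_unitarymx//.
by congr (_ *m diag_mx _ *m _); apply/rowP => k; rewrite mxE RRe_real.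
Qed.

Section spectral.
Variables (R : realType) (n : nat) (M : 'M[R]_n).
Variables (P : 'M[R[i]]_n) (d : 'I_n -> R).
Hypothesis Pu : P \is unitarymx.
Hypothesis ME : map_mx (real_complex R) M =
  (P ^t*)%sesqui *m diag_mx (\row_k (d k)%:C) *m P.

(** The rows of [P] give orthogonal rank-one projections [E k] with sum 1, so the matrix exponential
    splits into one scalar series for each [k]. *)
Lemma transmxE t a b :
  transmx M t a b = \sum_k cis (t * d k) * ((P k a)^* * P k b).
Proof.
pose E k : 'M[R[i]]_n := (P ^t*)%sesqui *m delta_mx k k *m P.
have EE k : E k a b = (P k a)^* * P k b.
  rewrite mxE (bigD1 k)//= big1 => [|l lk]; rewrite mxE.
    rewrite (bigD1 k)//= big1 => [|l lk]; rewrite !mxE ?eqxx ?mulr1 ?addr0//.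
    by rewrite (negbTE lk) mulr0.
  by rewrite big1 ?mul0r// => m _; rewrite !mxE (negbTE lk) andbF mulr0.
suff -> : transmx M t = \sum_k cis (t * d k) *: E k.
  by rewrite summxE; apply: eq_bigr => k _; rewrite mxE EE.
have ME' : map_mx (real_complex R) M = \sum_k (d k)%:C *: E k.
  rewrite ME diag_mx_sum_delta mulmx_sumr mulmx_suml; apply: eq_bigr => k _.
  by rewrite mxE -scalemxAr -scalemxAl.
have Emul k l : E k *m E l = if k == l then E k else 0.
  rewrite /E !mulmxA mulmxtVK// -(mulmxA _ (delta_mx k k) (delta_mx l l)).
  rewrite mul_delta_mx_cond.
  by case: eqP => [->|_]; rewrite ?mulr1n// mulr0n mulmx0 mul0mx.
have Esum : \sum_k E k = 1%:M.
  rewrite -mulmx_suml -mulmx_sumr -mx1_sum_delta mulmx1.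
  by rewrite -invmx_unitary// mulVmx// unitarymx_unit.
have XE j : ('i * t%:C *: map_mx (real_complex R) M) ^+ j =
    \sum_k ('i * (t * d k)%:C) ^+ j *: E k.
  elim: j => [|j IH].
    by rewrite expr0; under eq_bigr do rewrite expr0 scale1r; rewrite Esum.
  rewrite exprS IH ME' scaler_sumr mulr_suml; apply: eq_bigr => k _.
  rewrite mulr_sumr (bigD1 k)//= big1 ?addr0 => [|l lk].
    rewrite -[LHS]/(_ *m _) -!scalemxAl -scalemxAr Emul eqxx !scalerA.
    by rewrite exprS rmorphM/= !mulrA.
  rewrite -[LHS]/(_ *m _) -!scalemxAl -scalemxAr Emul eq_sym (negbTE lk).
  by rewrite !scaler0.
rewrite /transmx /expmx; apply: (@cvg_lim (matrix (R[i])^o n n)).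
  exact: norm_hausdorff.
rewrite (_ : series _ = fun N => \sum_k series (fun j =>
    (j`!%:R : R[i])^-1 * ('i * (t * d k)%:C) ^+ j : R[i]^o) N *: E k).
  apply: cvg_big => [|k _]; first exact: add_continuous.
  apply: cvgZ; last exact: cvg_cst.
  exact: cvg_series_cis.
apply/funext => N; rewrite /series /=.
under [RHS]eq_bigr do rewrite scaler_suml.
rewrite exchange_big/=; apply: eq_bigr => j _.
by rewrite XE scaler_sumr; apply: eq_bigr => k _; rewrite scalerA.
Qed.

Lemma unitary_cols i j : \sum_k (P k i)^* * P k j = (i == j)%:R.
Proof.
have /matrixP/(_ i j) : (P ^t*)%sesqui *m P = 1%:M.
  by rewrite -invmx_unitary// mulVmx// unitarymx_unit.
by rewrite !mxE => <-; apply: eq_bigr => k _; rewrite !mxE.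
Qed.

(** In the basis given by [P] the matrix is diagonal, so the [k]-th coordinate of [P x] is scaled by
    [d k] and by [theta] alike. *)
Lemma eigenvector_coords (x : 'cV[R]_n) theta k : M *m x = theta *: x ->
  d k != theta -> \sum_i P k i * (x i 0)%:C = 0.
Proof.
move=> Mx dk; set xC := map_mx (real_complex R) x.
have PxC l : (P *m xC) l 0 = \sum_i P l i * (x i 0)%:C.
  by rewrite mxE; apply: eq_bigr => i _; rewrite mxE.
have /matrixP/(_ k 0) : diag_mx (\row_k (d k)%:C) *m (P *m xC) =
    theta%:C *: (P *m xC).
  rewrite scalemxAr -map_mxZ -Mx map_mxM ME !mulmxA.
  by move/unitarymxP: Pu => ->; rewrite mul1mx.
rewrite mul_diag_mx !mxE -PxC => /eqP.
rewrite -subr_eq0 -mulrBl mulf_eq0 -rmorphB fmorph_eq0 subr_eq0 (negbTE dk)/=.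
by move=> /eqP <-; rewrite mxE.
Qed.

(** * Twin vertices in the eigenbasis *)

Variables (u v : 'I_n) (theta : R).
Hypothesis uv : u != v.
Hypothesis eig : M *m (delta_mx u 0 - delta_mx v 0) =
    theta *: (delta_mx u 0 - delta_mx v 0 : 'cV_n).

Lemma twin_coords k : d k != theta -> P k u = P k v.
Proof.
move=> /(eigenvector_coords eig) => /eqP.
under eq_bigr do rewrite !mxE !andbT rmorphB/= !rmorph_nat mulrBr.
rewrite sumrB (bigD1 u)//= eqxx mulr1 big1 => [|i /negbTE->]; last exact: mulr0.
rewrite (bigD1 v)//= eqxx mulr1 big1 => [|i /negbTE->]; last exact: mulr0.
by rewrite !addr0 subr_eq0 => /eqP.
Qed.

(* The squared norm of the component of [e_u] orthogonal to the eigenspace of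
   [theta]. *)
Let s := \sum_(k | d k != theta) `|P k u| ^+ 2.
Let Q t := \sum_(k | d k != theta) cis (t * d k) * `|P k u| ^+ 2.

(** By [twin_coords], [u] and [v] have equal coordinates here; hence the same [Q t] serves for both
    entries of the transition matrix. *)
Lemma sum_off_eigenspace (f : 'I_n -> R[i]) j : j \in [:: u; v] ->
  \sum_(k | d k != theta) f k * ((P k u)^* * P k j) =
  \sum_(k | d k != theta) f k * `|P k u| ^+ 2.
Proof.
move=> jE; apply: eq_bigr => k /twin_coords Puv.
rewrite sqr_normc mulrC [_ * _^*]mulrC.
by rewrite !inE in jE; case/orP: jE => /eqP ->; rewrite -?Puv mulrC.
Qed.

(** The columns of [P] are orthonormal, and the terms off the eigenspace add up to [s] for every
    choice of [i] and [j]. *)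
Lemma sum_on_eigenspace i j : i \in [:: u; v] -> j \in [:: u; v] ->
  \sum_(k | d k == theta) (P k i)^* * P k j = (i == j)%:R - s.
Proof.
move=> iE jE; apply/esym/eqP; rewrite subr_eq; apply/eqP.
rewrite -(unitary_cols i j) (bigID (fun k => d k == theta))/=; congr (_ + _).
apply: eq_bigr => k /twin_coords Puv; rewrite sqr_normc mulrC.
rewrite !inE in iE jE.
by case/orP: iE => /eqP ->; case/orP: jE => /eqP ->; rewrite -?Puv.
Qed.

Lemma transmx_twin t j : j \in [:: u; v] ->
  transmx M t u j = Q t + ((u == j)%:R - s) * cis (t * theta).
Proof.
move=> jE; rewrite transmxE (bigID (fun k => d k == theta))/=.
rewrite addrC sum_off_eigenspace//.
have uE : u \in [:: u; v] by rewrite !inE eqxx.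
congr (_ + _); rewrite -(sum_on_eigenspace uE jE) mulr_suml.
by apply: eq_bigr => k /eqP ->; rewrite mulrC.
Qed.

Lemma norm_off_phase_sum t : `|Q t| <= s.
Proof.
apply: le_trans (ler_norm_sum _ _ _) _; apply: ler_sum => k _.
by rewrite normrM normr_cis mul1r normrX normr_id.
Qed.

(** The two square terms give [1 - s] each and the two cross terms [- s] each. *)
Lemma sum_sqr_add : \sum_(k | d k == theta) `|P k u + P k v| ^+ 2 = 2 - 4 * s.
Proof.
under eq_bigr do rewrite sqr_normc mulrC rmorphD/= mulrDl !mulrDr.
rewrite !big_split/= !sum_on_eigenspace ?inE ?eqxx ?orbT//.
rewrite (negbTE uv) eq_sym (negbTE uv).
by rewrite mulr0n mulr1n; ring.
Qed.

(** In [y = P^* (P y)], the coordinates of [P y] vanish off the eigenspace of [theta]; on it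
    [sum_sqr_add] makes [P k u + P k v] vanish. *)
Lemma eigenvector_antisym (y : 'cV[R]_n) : s = 1 / 2 -> M *m y = theta *: y ->
  y u 0 + y v 0 = 0.
Proof.
move=> s12 My.
have Puv k : d k == theta -> P k u + P k v = 0.
  move=> dk; have /eqP := sum_sqr_add.
  rewrite s12 (_ : 2 - 4 * (1 / 2) = 0 :> R[i]); last by field.
  rewrite psumr_eq0 => [/allP/(_ k (mem_index_enum k))|l _]; last first.
    by rewrite exprn_ge0.
  by rewrite dk /= sqrf_eq0 normr_eq0 => /eqP.
have yE j : (y j 0)%:C = \sum_k (P k j)^* * \sum_i P k i * (y i 0)%:C.
  under eq_bigr do rewrite mulr_sumr.
  rewrite exchange_big/= (bigD1 j)//= [X in _ + X]big1 => [|i /negbTE ij].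
    under eq_bigr do rewrite mulrA.
    by rewrite -mulr_suml unitary_cols eqxx mul1r addr0.
  under eq_bigr do rewrite mulrA.
  by rewrite -mulr_suml unitary_cols eq_sym ij mul0r.
apply: (@complexI R); rewrite rmorphD/= !yE -big_split/= big1// => k _.
rewrite -mulrDl -rmorphD/=.
have [/eqP/Puv->|dk] := eqVneq (d k) theta; first by rewrite rmorph0 mul0r.
by rewrite (eigenvector_coords My dk) mulr0.
Qed.

Lemma off_weight_real : exists2 r, 0 <= r <= 1 / 2 & s = r%:C.
Proof.
have s0 : 0 <= s by apply: sumr_ge0 => k _; rewrite exprn_ge0.
have [r sE] : exists r, s = r%:C by apply/complex_realP; exact: ger0_real.
exists r => //; apply/andP; split; first by rewrite -ler0c -sE.
have : 0 <= 2 - 4 * s.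
  by rewrite -sum_sqr_add sumr_ge0// => k _; rewrite exprn_ge0.
rewrite sE -(rmorph_nat (real_complex R) 2) -(rmorph_nat (real_complex R) 4).
by rewrite -rmorphM -rmorphB ler0c; lra.
Qed.

Lemma pgst_off_weight : pretty_good_state_transfer M u v -> s = 1 / 2.
Proof.
have [r /andP[r0 r2] sE] := off_weight_real.
have half : 1 / 2 = (1 / 2 : R)%:C.
  by rewrite fmorph_div rmorph1 rmorph_nat.
rewrite sE half => pgst; congr _%:C; apply/eqP; rewrite eq_le r2 leNgt.
(* With this [e] the threshold [1 - e] is exactly the bound [(2 r)^2] on the squared entry. *)
apply/negP => rlt; have e0 : 0 < 1 - (2 * r) ^+ 2 by nra.
have [t /lt_geF/negP] := pgst _ e0; apply; rewrite opprB addrC subrK rmorphXn/=.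
apply: lerXn2r; rewrite ?nnegrE ?normr_ge0 ?ler0c//; first by rewrite mulr_ge0.
rewrite transmx_twin ?inE ?eqxx ?orbT// (negbTE uv) mulr0n sub0r.
apply: le_trans (ler_normD _ _) _; rewrite normrM normr_cis mulr1 normrN.
rewrite mulr_natl mulr2n rmorphD/= lerD//.
  by rewrite -sE norm_off_phase_sum.
by rewrite sE ger0_norm// ler0c.
Qed.

Lemma pfr_off_weight : proper_fractional_revival M u v -> s = 1 / 2.
Proof.
have [r /andP[r0 r2] sE] := off_weight_real.
have half : 1 / 2 = (1 / 2 : R)%:C.
  by rewrite fmorph_div rmorph1 rmorph_nat.
rewrite sE half => -[t [rev]]; move: r2; rewrite le_eqVlt => /orP[/eqP->//|r2].
move: rev; rewrite /fractional_revival !transmx_twin ?inE ?eqxx ?orbT//.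
rewrite (negbTE uv) mulr0n mulr1n sub0r mulNr sE => rev /eqP[].
apply: sum_sqr_norms_eq1 => //; first exact: normr_cis.
- by rewrite -sE norm_off_phase_sum.
- by rewrite rmorphB rmorph1.
Qed.

End spectral.

Lemma transmx_cospectral (R : realType) n (M : 'M[R]_n) u v theta : M^T = M ->
  u != v ->
  M *m (delta_mx u 0 - delta_mx v 0) =
    theta *: (delta_mx u 0 - delta_mx v 0 : 'cV_n) ->
  pretty_good_state_transfer M u v \/ proper_fractional_revival M u v ->
  strongly_cospectral M u v.
Proof.
move=> Msym uv eig transfer l _.
have [P [d [Pu ME]]] := spectral_real_sym Msym.
have anti (y : 'cV_n) : M *m y = theta *: y -> y u 0 + y v 0 = 0.
  apply: (eigenvector_antisym Pu ME uv eig).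
  by case: transfer; [exact: pgst_off_weight|exact: pfr_off_weight].
(* The projection factors through [eigenspace M l], so it suffices to test the rows of the latter on
   [e_u + e_v] or [e_u - e_v]. *)
have [W EW] : exists W, eigenproj M l = W *m eigenspace M l.
  apply/submxP; rewrite -[eigenproj M l]mul1mx; exact: proj_mx_sub.
have col_eig i :
    M *m (row i (eigenspace M l))^T = l *: (row i (eigenspace M l))^T.
  have /eigenspaceP SM := row_sub i (eigenspace M l).
  by move/(congr1 trmx): SM; rewrite trmx_mul Msym linearZ.
have [lE|lN] := eqVneq l theta; [right|left]; apply/eqP.
- rewrite -addr_eq0 -mulmxDr EW -mulmxA (_ : _ *m (_ + _) = 0) ?mulmx0//.
  apply/matrixP => i j; rewrite ord1 mulmxDr -!colE.
  have := anti _ (etrans (col_eig i) (congr1 (fun a => a *: _) lE)).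
  by rewrite !mxE.
- rewrite -subr_eq0 -mulmxBr EW -mulmxA (_ : _ *m (_ - _) = 0) ?mulmx0//.
  (* Eigenvectors of a symmetric matrix for distinct eigenvalues are orthogonal: [S *m M *m a] is
     computed in two ways. *)
  set S := eigenspace M l; set a := _ - _.
  have SM : S *m M = l *: S by apply/eigenspaceP.
  have /eqP : (l - theta) *: (S *m a) = 0.
    by rewrite scalerBl scalemxAl -SM -mulmxA eig -scalemxAr subrr.
  by rewrite scaler_eq0 subr_eq0 (negbTE lN) => /eqP.
Qed.

(** * Twins yield an eigenvector of both graph matrices *)

Section twins.
Variables (R : realType) (n : nat) (X : wgraph R n) (M : 'M[R]_n) (u v : 'I_n).
Hypothesis ME : M = adjmx X \/ M = lapmx X.

Lemma graphmx_sym : M^T = M.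
Proof.
have As : (adjmx X)^T = adjmx X by apply/matrixP => i j; rewrite mxE adjmx_sym.
by case: ME => ->//; rewrite /lapmx linearB/= As tr_diag_mx.
Qed.

Hypothesis uv : twins X u v.

(** If [w] is not a common neighbour, it is adjacent to neither twin and both weights are 0. *)
Lemma twins_adjmx w : w != u -> w != v -> adjmx X w u = adjmx X w v.
Proof.
case: uv => _ Nuv Auv _ wu wv.
have wN x : (w \in neighbours X x :\: [set u; v]) = (adjmx X x w != 0).
  by rewrite !inE negb_or wu wv.
rewrite !(adjmx_sym X w); have [w0|] := eqVneq (adjmx X u w) 0.
  by rewrite w0; apply/esym/eqP; rewrite -[_ == _]negbK -wN -Nuv wN w0 eqxx.
by rewrite -wN => /Auv.
Qed.

Lemma twins_eigenvector :
  exists theta, M *m (delta_mx u 0 - delta_mx v 0) =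
    theta *: (delta_mx u 0 - delta_mx v 0 : 'cV_n).
Proof.
have [uv_neq Nuv Auv Auuvv] := uv.
(* The [u] entry of [M (e_u - e_v)]; the [v] entry is its opposite and all others cancel. *)
exists (M u u - M u v).
rewrite mulmxBr -!colE.
have Muuvv : M u u = M v v.
  have degE : degree X u = degree X v.
    rewrite /degree Auuvv; congr (_ + _).
    (* Swapping [u] and [v] pairs loop with loop and the edge between the twins with itself. *)
    rewrite (reindex_inj (@perm_inj _ (tperm u v)))/=.
    apply: eq_bigr => w _; case: tpermP => [->|->|/eqP wu /eqP wv].
    - by rewrite adjmx_sym.
    - by rewrite Auuvv.
    - by rewrite 2!(adjmx_sym X _ w) twins_adjmx.
  by case: ME => ->//; rewrite /lapmx /degmx !mxE degE Auuvv !eqxx.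
have Mw w : w != u -> w != v -> M w u = M w v.
  move=> wu wv; case: ME => ->; first exact: twins_adjmx.
  by rewrite /lapmx /degmx !mxE (twins_adjmx wu wv) (negbTE wu) (negbTE wv).
have Msym i j : M i j = M j i by rewrite -[in LHS]graphmx_sym mxE.
apply/matrixP => w j; rewrite !mxE ord1 !andbT.
have [->|wu] := eqVneq w u; first by rewrite (negbTE uv_neq) subr0 mulr1.
have [->|wv] := eqVneq w v; first by rewrite (Msym v) Muuvv sub0r mulrN1 opprB.
by rewrite (Mw _ wu wv) !subrr mulr0.
Qed.
End twins.

Theorem theorem4p3 (R : realType) (n : nat) (X : wgraph R n) (M : 'M[R]_n)
    (u v : 'I_n) :
  connected_graph X ->
  M = adjmx X \/ M = lapmx X ->
  twins X u v ->
  pretty_good_state_transfer M u v \/ proper_fractional_revival M u v ->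
  strongly_cospectral M u v.
Proof.
move=> _ ME uv; have [theta eig] := twins_eigenvector ME uv.
apply: transmx_cospectral eig; first exact: graphmx_sym ME.
by case: uv.
Qed.
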